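(* Let $\Omega\subset\mathbb{C}$ be open, let $f:\Omega\to\mathbb{C}$ be analytic, and let $z_0\in\Omega$ satisfy $f'(z_0)\ne 0$. Then there exists $r>0$ such that, with $D(z_0;r)=\{z\in\mathbb{C}:|z-z_0|<r\}$: (a) $D(z_0;r)\subset\Omega$ and $f$ is injective in $D(z_0;r)$. (b) $V=f\big(D(z_0;r)\big)$ is an open set containing $f(z_0)$. (c) $\varphi=f|_{D(z_0;r)}:D(z_0;r)\to V$ is invertible and its inverse is continuous. (d) $\varphi^{-1}:V\to D(z_0;r)$ is complex-differentiable.
   Context: A function $f:\Omega\to\mathbb{C}$ on an open set $\Omega\subset\mathbb{C}$ is analytic if around each $z_0\in\Omega$ it is given on some open disk centered at $z_0$ and contained in $\Omega$ by a convergent power series in $z-z_0$. A function on an open set is complex-differentiable if it has a complex derivative at every point of that set. *)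

(* Defs.v *)
From Stdlib Require Import Reals.
From Coquelicot Require Import Coquelicot.

Definition disk (c : C) (r : R) : C -> Prop :=
  fun z => (Cmod (z - c)%C < r)%R.

(* A function with domain Omega is a total function C -> C whose values outside
   Omega are irrelevant; the predicates below only look at values in the domain. *)

Definition analytic_on (Omega : C -> Prop) (f : C -> C) : Prop :=
  forall c : C, Omega c ->
    exists rho : R, (0 < rho)%R /\
      (forall z : C, disk c rho z -> Omega z) /\
      exists a : nat -> C,
        forall z : C, disk c rho z -> is_pseries a (z - c)%C (f z).

Definition injective_on (D : C -> Prop) (f : C -> C) : Prop :=
  forall z w : C, D z -> D w -> f z = f w -> z = w.

Definition image (f : C -> C) (D : C -> Prop) : C -> Prop :=
  fun w => exists z : C, D z /\ f z = w.

(* g restricted to V is the two-sided inverse of f restricted to D, as a map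
   from D to V. *)
Definition inverse_on (D V : C -> Prop) (f g : C -> C) : Prop :=
  (forall z : C, D z -> V (f z) /\ g (f z) = z) /\
  (forall w : C, V w -> D (g w) /\ f (g w) = w).

(* Used for open V only, where the derivative at a point of V does not depend
   on the values of g outside V. *)
Definition complex_differentiable_on (V : C -> Prop) (g : C -> C) : Prop :=
  forall w : C, V w -> ex_derive g w.

(* Main.v *)
Require Import Defs.
From Stdlib Require Import Reals.
From Coquelicot Require Import Coquelicot.
From Stdlib Require Import Lra Lia ClassicalEpsilon.

(** The proof is the contraction-mapping proof of the inverse function theorem,
    fed by one estimate on power series.

    If [f] is the sum of [a_n (z - c)^n] on a disk about [c], then it is
    strictly differentiable at [c] with derivative [a_1]: the remainder
    [f z - f w - a_1 (z - w)] is at most [eps |z - w|] for all [z], [w] in a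
    small enough disk about [c], because in the differences
    [(z - c)^n - (w - c)^n] with [2 <= n] one can factor out [z - w] and the
    rest is small with the radius of the disk
    ([pseries_strict_derivative]).  Two moving points matter: with [w = c]
    alone the estimate would be differentiability at [c], which says nothing
    about injectivity near [c].

    Let [l] be the derivative of [f] at [z0] and take [eps = |l| / 2]: on some
    disk [D] about [z0], [f] differs from the linear map [l z] by a map with
    Lipschitz constant [|l| / 2] ([approx_linear_on]).  Everything else follows
    from this.  The triangle inequality gives
    [|l| / 2 |z - w| <= |f z - f w|], so that [f] is injective on [D], its
    inverse is Lipschitz, and no derivative of [f] in [D] vanishes.  The
    Newton-like map [z - (f z - w) / l] with frozen slope [l] is a
    contraction whose fixed points solve [f z = w]; it preserves a small disk
    about any [c] in [D] as soon as [w] is near [f c], so that the image of [D]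
    is open ([approx_linear_surjective]).

    For the derivative of the inverse at [f z], analyticity is used again, now
    at the point [z] of [D]: [f] has a derivative [m] there, it is not zero,
    and since the inverse is Lipschitz the error
    [f z' - f z - m (z' - z)], negligible with respect to [z' - z], is also
    negligible with respect to [f z' - f z] ([inverse_is_derive]). *)

Local Open Scope R_scope.

(** * Modulus, disks and limits in the complex plane *)

Lemma Cmod_minus_sym (z w : C) : Cmod (z - w)%C = Cmod (w - z)%C.
Proof.
  replace (z - w)%C with (- (w - z))%C by ring.
  apply Cmod_opp.
Qed.

Lemma Cmod_minus_triangle (u v w : C) :
  Cmod (u - w)%C <= Cmod (u - v)%C + Cmod (v - w)%C.
Proof.
  replace (u - w)%C with ((u - v) + (v - w))%C by ring.
  apply Cmod_triangle.
Qed.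

Lemma Cmod_reverse_triangle (u v : C) : Cmod u - Cmod v <= Cmod (u - v)%C.
Proof.
  assert (H := Cmod_triangle (u - v) v).
  replace (u - v + v)%C with u in H by ring.
  lra.
Qed.

Lemma disk_center (c : C) (r : R) : 0 < r -> disk c r c.
Proof.
  intros Hr; unfold disk.
  replace (c - c)%C with (RtoC 0) by ring.
  rewrite Cmod_0; exact Hr.
Qed.

(** The neighbourhoods of the plane are defined by squares (balls of the product
    of two lines); squares and disks contain each other up to a factor
    [sqrt 2]. *)
Lemma locally_disk (c : C) (P : C -> Prop) :
  @locally C_UniformSpace c P <->
  exists r : R, 0 < r /\ forall z : C, disk c r z -> P z.
Proof.
  split.
  - intros [eps Heps].
    exists eps; split; [apply cond_pos|].
    intros z Hz.
    apply Heps, C_NormedModule_mixin_compat1, Hz.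
  - intros (r & Hr & Hdisk).
    assert (Hs : 0 < sqrt 2) by (apply sqrt_lt_R0; lra).
    assert (He : 0 < r / sqrt 2) by (apply Rdiv_lt_0_compat; lra).
    exists (mkposreal _ He).
    intros z Hz.
    apply Hdisk.
    apply C_NormedModule_mixin_compat2 in Hz.
    unfold disk.
    replace r with (sqrt 2 * (r / sqrt 2)) by (field; lra).
    exact Hz.
Qed.

(** A form of the derivative that mentions only the modulus.  The derivative
    takes its neighbourhoods from the absolute value of the field, hence the
    passage through [locally_C]. *)
Lemma is_derive_of_Cmod (g : C -> C) (c m : C) :
  (forall eps : R, 0 < eps -> exists d : R, 0 < d /\
     forall z : C, disk c d z ->
       Cmod (g z - g c - m * (z - c))%C <= eps * Cmod (z - c)%C) ->
  @is_derive C_AbsRing C_NormedModule g c m.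
Proof.
  intros H.
  split.
  - apply is_linear_scal_l.
  - intros x Hx eps.
    assert (E : c = x).
    { exact (@is_filter_lim_locally_unique _ (AbsRing_NormedModule C_AbsRing) c x Hx). }
    subst x.
    apply (proj1 (locally_C c _)).
    apply locally_disk.
    destruct (H eps (cond_pos eps)) as (d & Hd & Hbound).
    exists d; split; [exact Hd|].
    intros z Hz.
    change (Cmod (g z - g c - (z - c) * m)%C <= eps * Cmod (z - c)%C).
    rewrite (Cmult_comm (z - c) m).
    exact (Hbound z Hz).
Qed.

Lemma is_series_Cmod (t : nat -> C) (l : C) :
  @is_series C_AbsRing C_NormedModule t l ->
  forall eps : R, 0 < eps -> exists N : nat, forall n : nat, (N <= n)%nat ->
    Cmod (@sum_n C_NormedModule t n - l)%C < eps.
Proof.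
  intros H eps Heps.
  destruct (H (disk l eps)) as [N HN].
  - apply locally_disk.
    exists eps; auto.
  - exists N; exact HN.
Qed.

Lemma is_series_terms_bounded (t : nat -> C) (l : C) :
  @is_series C_AbsRing C_NormedModule t l ->
  exists M : R, forall n : nat, Cmod (t n) <= M.
Proof.
  intros H.
  destruct (filterlim_bounded (@sum_n C_NormedModule t)) as [M HM].
  { exists l; exact H. }
  exists (2 * M).
  assert (HM' : forall n, Cmod (@sum_n C_NormedModule t n) <= M).
  { intros n; exact (HM n). }
  intros [|n].
  - assert (H0 := HM' 0%nat).
    rewrite sum_O in H0.
    assert (Hp := Cmod_ge_0 (t 0%nat)).
    lra.
  - assert (H1 := HM' (S n)).
    assert (H2 := HM' n).
    rewrite sum_Sn in H1.
    set (s := @sum_n C_NormedModule t n) in *.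
    change (Cmod (s + t (S n))%C <= M) in H1.
    assert (H3 := Cmod_triangle (s + t (S n)) (- s)).
    rewrite Cmod_opp in H3.
    replace (s + t (S n) + - s)%C with (t (S n)) in H3 by ring.
    lra.
Qed.

Lemma Cmod_le_Rabs_Re_Im (z : C) : Cmod z <= Rabs (Re z) + Rabs (Im z).
Proof.
  replace z with (RtoC (Re z) + Ci * RtoC (Im z))%C at 1.
  - eapply Rle_trans; [apply Cmod_triangle|].
    rewrite Cmod_mult, Cmod_Ci, !Cmod_R; lra.
  - destruct z as [p q].
    apply injective_projections; simpl; ring.
Qed.

Lemma im_le_Cmod (z : C) : Rabs (Im z) <= Cmod z.
Proof.
  eapply Rle_trans; [|apply Rmax_Cmod].
  apply Rmax_r.
Qed.

(** Completeness is inherited from the real line through real and imaginary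
    parts. *)
Lemma C_complete (u : nat -> C) :
  (forall eps : R, 0 < eps -> exists N : nat, forall n m : nat,
     (N <= n)%nat -> (N <= m)%nat -> Cmod (u n - u m)%C < eps) ->
  exists l : C, forall eps : R, 0 < eps -> exists N : nat, forall n : nat,
    (N <= n)%nat -> Cmod (u n - l)%C < eps.
Proof.
  intros Hu.
  assert (Hre : ex_finite_lim_seq (fun n => Re (u n))).
  { apply ex_lim_seq_cauchy_corr; intros eps.
    destruct (Hu eps (cond_pos eps)) as [N HN].
    exists N; intros n m Hn Hm.
    apply Rle_lt_trans with (2 := HN n m Hn Hm).
    exact (re_le_Cmod (u n - u m)%C). }
  assert (Him : ex_finite_lim_seq (fun n => Im (u n))).
  { apply ex_lim_seq_cauchy_corr; intros eps.
    destruct (Hu eps (cond_pos eps)) as [N HN].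
    exists N; intros n m Hn Hm.
    apply Rle_lt_trans with (2 := HN n m Hn Hm).
    exact (im_le_Cmod (u n - u m)%C). }
  destruct Hre as [p Hp], Him as [q Hq].
  apply is_lim_seq_spec in Hp.
  apply is_lim_seq_spec in Hq.
  exists (p, q); intros eps Heps.
  assert (He : 0 < eps / 2) by lra.
  destruct (Hp (mkposreal _ He)) as [N1 HN1].
  destruct (Hq (mkposreal _ He)) as [N2 HN2].
  exists (N1 + N2)%nat; intros n Hn.
  specialize (HN1 n ltac:(lia)).
  specialize (HN2 n ltac:(lia)).
  simpl in HN1, HN2.
  eapply Rle_lt_trans; [apply Cmod_le_Rabs_Re_Im|].
  change (Rabs (Re (u n) - p) + Rabs (Im (u n) - q) < eps).
  lra.
Qed.

(** The iterates of [c] stay in the disk, and [T^(n + k) c] and [T^n c] are the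
    images under the [n]-th iterate of two points at distance at most [s], hence
    at distance at most [q^n s]: the sequence is Cauchy. *)
Lemma contraction_fixed_point (T : C -> C) (c : C) (s q : R) :
  0 <= s -> 0 <= q < 1 ->
  (forall z : C, Cmod (z - c)%C <= s -> Cmod (T z - c)%C <= s) ->
  (forall z w : C, Cmod (z - c)%C <= s -> Cmod (w - c)%C <= s ->
     Cmod (T z - T w)%C <= q * Cmod (z - w)%C) ->
  exists z : C, Cmod (z - c)%C <= s /\ T z = z.
Proof.
  intros Hs Hq Hball HT.
  set (u := fun n => Nat.iter n T c).
  assert (Hu : forall n, Cmod (u n - c)%C <= s).
  { induction n as [|n IH]; [|exact (Hball _ IH)].
    simpl; replace (c - c)%C with (RtoC 0) by ring.
    rewrite Cmod_0; exact Hs. }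
  assert (Hshift : forall n k, Cmod (u (n + k)%nat - u n)%C <= q ^ n * s).
  { induction n as [|n IH]; intros k.
    - simpl; rewrite Rmult_1_l; apply Hu.
    - change (u (S n + k)%nat) with (T (u (n + k)%nat)).
      change (u (S n)) with (T (u n)).
      eapply Rle_trans; [apply HT; apply Hu|].
      simpl pow; rewrite Rmult_assoc.
      apply Rmult_le_compat_l; [lra|apply IH]. }
  destruct (C_complete u) as [l Hl].
  { intros eps Heps.
    destruct (pow_lt_1_zero q ltac:(rewrite Rabs_pos_eq; lra)
      (eps / (2 * (s + 1)))) as [N HN].
    { apply Rdiv_lt_0_compat; lra. }
    specialize (HN N (le_n N)).
    assert (Hp : 0 <= q ^ N) by (apply pow_le; lra).
    rewrite Rabs_pos_eq in HN by exact Hp.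
    apply Rlt_div_r in HN; [|lra].
    exists N; intros n m Hn Hm.
    assert (H1 := Hshift N (n - N)%nat).
    assert (H2 := Hshift N (m - N)%nat).
    replace (N + (n - N))%nat with n in H1 by lia.
    replace (N + (m - N))%nat with m in H2 by lia.
    assert (H3 := Cmod_minus_triangle (u n) (u N) (u m)).
    rewrite (Cmod_minus_sym (u N) (u m)) in H3.
    assert (H4 : q ^ N * (2 * (s + 1)) = 2 * (q ^ N * s) + 2 * q ^ N) by ring.
    lra. }
  assert (Hlc : Cmod (l - c)%C <= s).
  { apply Rle_plus_epsilon; intros e He.
    destruct (Hl e He) as [N HN].
    specialize (HN N (le_n N)).
    assert (H := Cmod_minus_triangle l (u N) c).
    rewrite (Cmod_minus_sym l (u N)) in H.
    assert (H' := Hu N); lra. }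
  exists l; split; [exact Hlc|].
  assert (Hfix : Cmod (T l - l)%C <= 0).
  { apply Rle_plus_epsilon; intros e He.
    destruct (Hl (e / 2) ltac:(lra)) as [N HN].
    assert (H1 := HN N (le_n N)).
    assert (H2 := HN (S N) (le_S _ _ (le_n N))).
    change (u (S N)) with (T (u N)) in H2.
    assert (H3 := Cmod_minus_triangle (T l) (T (u N)) l).
    assert (H4 := HT l (u N) Hlc (Hu N)).
    rewrite (Cmod_minus_sym l (u N)) in H4.
    assert (H5 : q * Cmod (u N - l)%C <= 1 * Cmod (u N - l)%C).
    { apply Rmult_le_compat_r; [apply Cmod_ge_0|lra]. }
    lra. }
  assert (H0 : (T l - l)%C = RtoC 0).
  { apply Cmod_eq_0, Rle_antisym; [exact Hfix|apply Cmod_ge_0]. }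
  replace (T l) with ((T l - l) + l)%C by ring.
  rewrite H0; ring.
Qed.


(** * Strict differentiability of power series *)

(** By induction, from [x x^n - y y^n = x (x^n - y^n) + y^n (x - y)]. *)
Lemma Cmod_pow_diff (x y : C) (r : R) (n : nat) :
  Cmod x <= r -> Cmod y <= r ->
  Cmod (x ^ S n - y ^ S n)%C <= INR (S n) * r ^ n * Cmod (x - y)%C.
Proof.
  intros Hx Hy.
  assert (Hr : 0 <= r) by (apply Rle_trans with (2 := Hx), Cmod_ge_0).
  induction n as [|n IH].
  - simpl; rewrite !Cmult_1_r; lra.
  - replace (x ^ S (S n) - y ^ S (S n))%C
      with (x * (x ^ S n - y ^ S n) + y ^ S n * (x - y))%C by (simpl; ring).
    eapply Rle_trans; [apply Cmod_triangle|].
    rewrite !Cmod_mult, Cmod_pow.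
    assert (Hp : Cmod y ^ S n <= r ^ S n).
    { apply pow_incr; split; [apply Cmod_ge_0|exact Hy]. }
    assert (Hd := Cmod_ge_0 (x - y)).
    assert (H1 : Cmod x * Cmod (x ^ S n - y ^ S n)
                 <= r * (INR (S n) * r ^ n * Cmod (x - y))).
    { apply Rmult_le_compat; auto using Cmod_ge_0. }
    assert (H2 : Cmod y ^ S n * Cmod (x - y) <= r ^ S n * Cmod (x - y)).
    { apply Rmult_le_compat_r; assumption. }
    rewrite (S_INR (S n)).
    replace ((INR (S n) + 1) * r ^ S n * Cmod (x - y))
      with (r * (INR (S n) * r ^ n * Cmod (x - y)) + r ^ S n * Cmod (x - y))
      by (simpl; ring).
    lra.
Qed.

(** Both points move: this is stronger than having derivative [l] at [c], and it
    is what controls the injectivity of [f] near [c]. *)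
Definition strict_derivative (f : C -> C) (c l : C) : Prop :=
  forall eps : R, 0 < eps -> exists d : R, 0 < d /\
    forall z w : C, disk c d z -> disk c d w ->
      Cmod (f z - f w - l * (z - w))%C <= eps * Cmod (z - w)%C.

Lemma strict_derivative_is_derive (f : C -> C) (c l : C) :
  strict_derivative f c l -> @is_derive C_AbsRing C_NormedModule f c l.
Proof.
  intros H.
  apply is_derive_of_Cmod.
  intros eps Heps.
  destruct (H eps Heps) as (d & Hd & Hbound).
  exists d; split; [exact Hd|].
  intros z Hz.
  apply Hbound; [exact Hz|apply disk_center, Hd].
Qed.

Lemma pow2_ge_S (n : nat) : INR (S (S n)) <= 2 * 2 ^ n.
Proof.
  induction n as [|n IH].
  - simpl; lra.
  - rewrite S_INR.
    assert (H : 1 <= 2 ^ n) by (apply pow_R1_Rle; lra).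
    simpl pow; lra.
Qed.

(** [Cmod_pow_diff] bounds the term of degree [n + 2] by
    [(n + 2) r^(n + 1) |a| |x - y|], and [|a| <= M / r0^(n + 2)].  Since
    [r / r0 <= 1 / 4] and [n + 2 <= 2 * 2^n], the factor [(n + 2) (r / r0)^n] is
    at most [2 (1 / 2)^n], which is summable; one factor [r] remains, and makes
    the total small with [r]. *)
Lemma pseries_term_diff (a x y : C) (M r r0 : R) (n : nat) :
  0 < r0 -> r <= r0 / 4 -> Cmod x <= r -> Cmod y <= r ->
  Cmod (a * r0 ^ S (S n))%C <= M ->
  Cmod (a * x ^ S (S n) - a * y ^ S (S n))%C
    <= 2 * M * r / r0 ^ 2 * Cmod (x - y)%C * (1 / 2) ^ n.
Proof.
  intros Hr0 Hr Hx Hy HM.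
  assert (Hr' : 0 <= r) by (apply Rle_trans with (2 := Hx), Cmod_ge_0).
  assert (Hd := Cmod_ge_0 (x - y)).
  assert (Ha := Cmod_ge_0 a).
  replace (a * x ^ S (S n) - a * y ^ S (S n))%C
    with (a * (x ^ S (S n) - y ^ S (S n)))%C by ring.
  rewrite Cmod_mult.
  assert (Hpow := Cmod_pow_diff x y r (S n) Hx Hy).
  rewrite Cmod_mult, Cmod_pow, Cmod_R, Rabs_pos_eq in HM by lra.
  assert (Hq : 0 < r0 ^ S (S n)) by (apply pow_lt; lra).
  assert (HaM : Cmod a <= M / r0 ^ S (S n)).
  { apply Rle_div_r; assumption. }
  assert (HM0 : 0 <= M).
  { eapply Rle_trans; [|exact HM]; apply Rmult_le_pos; lra. }
  assert (Hrn : r ^ n <= (r0 / 4) ^ n) by (apply pow_incr; lra).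
  assert (Hrn0 : 0 <= r ^ n) by (apply pow_le; lra).
  assert (Hin : INR (S (S n)) * r ^ n <= (2 * 2 ^ n) * (r0 / 4) ^ n).
  { apply Rmult_le_compat; [apply pos_INR|assumption|apply pow2_ge_S|assumption]. }
  replace ((2 * 2 ^ n) * (r0 / 4) ^ n) with (2 * (1 / 2) ^ n * r0 ^ n) in Hin.
  2:{ replace (r0 / 4) with (/ 2 * (1 / 2) * r0) by field.
      rewrite !Rpow_mult_distr, pow_inv.
      field; apply pow_nonzero; lra. }
  assert (H1 : Cmod (x ^ S (S n) - y ^ S (S n))%C
                 <= 2 * (1 / 2) ^ n * r0 ^ n * (r * Cmod (x - y)%C)).
  { eapply Rle_trans; [exact Hpow|].
    replace (INR (S (S n)) * r ^ S n * Cmod (x - y)%C)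
      with (INR (S (S n)) * r ^ n * (r * Cmod (x - y)%C)) by (simpl pow; ring).
    apply Rmult_le_compat_r; [apply Rmult_le_pos; lra|exact Hin]. }
  eapply Rle_trans.
  { apply Rmult_le_compat; [exact Ha|apply Cmod_ge_0|exact HaM|exact H1]. }
  apply Req_le.
  assert (r0 ^ n <> 0) by (apply pow_nonzero; lra).
  simpl pow; field; split; [lra|assumption].
Qed.

Lemma pow_n_Cpow (x : C) (n : nat) : @pow_n C_Ring x n = (x ^ n)%C.
Proof.
  induction n as [|n IH]; simpl; [reflexivity|].
  rewrite IH; reflexivity.
Qed.

(** Adds up the terms of degree [2] to [n + 1] by [pseries_term_diff]; the last
    factor is the geometric sum [1 + 1/2 + ... + (1/2)^(n - 1)].  The sum runs to
    [S n] so that the linear term, which is subtracted, is always present. *)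
Lemma pseries_partial_sum_diff (a : nat -> C) (x y : C) (M r r0 : R) (n : nat) :
  0 < r0 -> r <= r0 / 4 -> Cmod x <= r -> Cmod y <= r ->
  (forall k : nat, Cmod (a k * r0 ^ k)%C <= M) ->
  Cmod (@sum_n C_NormedModule (fun k => (a k * x ^ k)%C) (S n)
        - @sum_n C_NormedModule (fun k => (a k * y ^ k)%C) (S n)
        - a 1%nat * (x - y))%C
    <= 2 * M * r / r0 ^ 2 * Cmod (x - y)%C * (2 - 2 * (1 / 2) ^ n).
Proof.
  intros Hr0 Hr Hx Hy HM.
  induction n as [|n IH].
  - rewrite !sum_Sn, !sum_O.
    change (@plus C_NormedModule) with Cplus.
    match goal with |- Cmod ?e <= _ => replace e with (RtoC 0) by (simpl; ring) end.
    rewrite Cmod_0; simpl; lra.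
  - rewrite (sum_Sn _ (S n)), (@sum_Sn C_NormedModule (fun k => (a k * y ^ k)%C) (S n)).
    set (sx := @sum_n C_NormedModule (fun k => (a k * x ^ k)%C) (S n)) in *.
    set (sy := @sum_n C_NormedModule (fun k => (a k * y ^ k)%C) (S n)) in *.
    change (@plus C_NormedModule) with Cplus.
    assert (Ht := pseries_term_diff (a (S (S n))) x y M r r0 n Hr0 Hr Hx Hy (HM _)).
    match goal with |- Cmod ?e <= _ =>
      replace e with ((sx - sy - a 1%nat * (x - y))
        + (a (S (S n)) * x ^ S (S n) - a (S (S n)) * y ^ S (S n)))%C by ring end.
    eapply Rle_trans; [apply Cmod_triangle|].
    replace ((1 / 2) ^ S n) with (1 / 2 * (1 / 2) ^ n) by reflexivity.
    lra.
Qed.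

(** At the real offset [r0], half the given radius, the series converges, so that
    its terms are bounded by some [M]; passing to the limit in
    [pseries_partial_sum_diff] bounds the remainder on the disk of radius [d] by
    [(4 M d / r0^2) |z - w|], and [d] is chosen to make the factor at most
    [eps]. *)
Lemma pseries_strict_derivative (f : C -> C) (c : C) (rho : R) (a : nat -> C) :
  0 < rho ->
  (forall z : C, disk c rho z ->
     @is_pseries C_AbsRing C_NormedModule a (z - c)%C (f z)) ->
  strict_derivative f c (a 1%nat).
Proof.
  intros Hrho Hf.
  assert (Hs : forall z, disk c rho z ->
    @is_series C_AbsRing C_NormedModule (fun k => (a k * (z - c) ^ k)%C) (f z)).
  { intros z Hz.
    eapply is_series_ext; [|exact (Hf z Hz)].
    intros k.
    change (@pow_n C_Ring (z - c)%C k * a k = a k * (z - c) ^ k)%C.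
    rewrite pow_n_Cpow; ring. }
  set (r0 := rho / 2).
  assert (Hr0 : 0 < r0) by (unfold r0; lra).
  assert (HM : exists M, forall k, Cmod (a k * r0 ^ k)%C <= M).
  { apply (is_series_terms_bounded _ (f (c + r0)%C)).
    eapply is_series_ext; [|apply (Hs (c + r0)%C)].
    - intros k; simpl.
      replace (c + r0 - c)%C with (RtoC r0) by ring; reflexivity.
    - unfold disk.
      replace (c + r0 - c)%C with (RtoC r0) by ring.
      rewrite Cmod_R, Rabs_pos_eq; unfold r0; lra. }
  destruct HM as [M HM].
  assert (HM0 : 0 <= M).
  { eapply Rle_trans; [apply Cmod_ge_0|apply (HM 0%nat)]. }
  intros eps Heps.
  (* [M + 1] rather than [M], which may be zero. *)
  set (d := Rmin (r0 / 4) (eps * r0 ^ 2 / (4 * (M + 1)))).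
  assert (Hq : 0 < r0 ^ 2) by (apply pow_lt; exact Hr0).
  assert (Hd : 0 < d).
  { apply Rmin_pos; [lra|].
    apply Rdiv_lt_0_compat; [apply Rmult_lt_0_compat|]; lra. }
  assert (Hd1 : d <= r0 / 4) by apply Rmin_l.
  assert (Hd2 : 4 * M * d / r0 ^ 2 <= eps).
  { apply Rle_div_l; [exact Hq|].
    assert (H : d <= eps * r0 ^ 2 / (4 * (M + 1))) by apply Rmin_r.
    apply Rle_div_r in H; [|lra].
    lra. }
  exists d; split; [exact Hd|].
  intros z w Hz Hw.
  unfold disk in Hz, Hw.
  assert (Hdz := Cmod_ge_0 (z - w)).
  apply Rle_plus_epsilon; intros e He.
  destruct (is_series_Cmod _ _ (Hs z ltac:(unfold disk, r0 in *; lra)) (e / 2)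
    ltac:(lra)) as [N1 HN1].
  destruct (is_series_Cmod _ _ (Hs w ltac:(unfold disk, r0 in *; lra)) (e / 2)
    ltac:(lra)) as [N2 HN2].
  set (n := (N1 + N2)%nat).
  specialize (HN1 (S n) ltac:(unfold n; lia)).
  specialize (HN2 (S n) ltac:(unfold n; lia)).
  assert (Hp := pseries_partial_sum_diff a (z - c) (w - c) M d r0 n Hr0 Hd1
    ltac:(lra) ltac:(lra) HM).
  set (sz := @sum_n C_NormedModule (fun k => (a k * (z - c) ^ k)%C) (S n)) in *.
  set (sw := @sum_n C_NormedModule (fun k => (a k * (w - c) ^ k)%C) (S n)) in *.
  replace (z - c - (w - c))%C with (z - w)%C in Hp by ring.
  assert (Hb : Cmod (sz - sw - a 1%nat * (z - w))%C <= eps * Cmod (z - w)).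
  { eapply Rle_trans; [exact Hp|].
    assert (Hn : 0 < (1 / 2) ^ n) by (apply pow_lt; lra).
    replace (2 * M * d / r0 ^ 2 * Cmod (z - w) * (2 - 2 * (1 / 2) ^ n))
      with (4 * M * d / r0 ^ 2 * Cmod (z - w) * (1 - (1 / 2) ^ n)) by (field; lra).
    assert (H0 : 0 <= 4 * M * d / r0 ^ 2 * Cmod (z - w)).
    { apply Rmult_le_pos; [|exact Hdz].
      apply Rle_div_r; [exact Hq|].
      rewrite Rmult_0_l; apply Rmult_le_pos; lra. }
    assert (H1 : 4 * M * d / r0 ^ 2 * Cmod (z - w) <= eps * Cmod (z - w)).
    { apply Rmult_le_compat_r; assumption. }
    assert (H2 : 0 <= 4 * M * d / r0 ^ 2 * Cmod (z - w) * (1 / 2) ^ n).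
    { apply Rmult_le_pos; lra. }
    lra. }
  replace (f z - f w - a 1%nat * (z - w))%C
    with ((sz - sw - a 1%nat * (z - w)) + ((f z - sz) + (sw - f w)))%C by ring.
  eapply Rle_trans; [apply Cmod_triangle|].
  assert (H := Cmod_triangle (f z - sz) (sw - f w)).
  rewrite (Cmod_minus_sym (f z) sz) in H.
  lra.
Qed.

(** * Maps close to an invertible linear map *)

(** The factor [1 / 2] could be any constant below [1]: what counts is that the
    deviation of [f] from the map [l z] has a Lipschitz constant smaller than
    [|l|], the factor by which that map expands distances. *)
Definition approx_linear_on (D : C -> Prop) (f : C -> C) (l : C) : Prop :=
  forall z w : C, D z -> D w ->
    Cmod (f z - f w - l * (z - w))%C <= Cmod l / 2 * Cmod (z - w)%C.

Lemma approx_linear_expanding (D : C -> Prop) (f : C -> C) (l : C) :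
  approx_linear_on D f l ->
  forall z w : C, D z -> D w ->
    Cmod l / 2 * Cmod (z - w)%C <= Cmod (f z - f w)%C.
Proof.
  intros H z w Hz Hw.
  assert (H1 := H z w Hz Hw).
  assert (H2 := Cmod_reverse_triangle (l * (z - w)) (f z - f w)).
  rewrite (Cmod_minus_sym (l * (z - w))), Cmod_mult in H2.
  lra.
Qed.

Lemma approx_linear_injective (D : C -> Prop) (f : C -> C) (l : C) :
  l <> RtoC 0 -> approx_linear_on D f l -> injective_on D f.
Proof.
  intros Hl H z w Hz Hw E.
  apply Cmod_gt_0 in Hl.
  assert (H1 := approx_linear_expanding D f l H z w Hz Hw).
  replace (f z - f w)%C with (RtoC 0) in H1 by (rewrite E; ring).
  rewrite Cmod_0 in H1.
  assert (H0 : (z - w)%C = RtoC 0).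
  { apply Cmod_eq_0, Rle_antisym; [|apply Cmod_ge_0].
    apply Rmult_le_reg_l with (Cmod l / 2); lra. }
  replace z with ((z - w) + w)%C by ring.
  rewrite H0; ring.
Qed.

(** Solving [f z = w] amounts to finding a fixed point of
    [T z = z - (f z - w) / l].  Dividing the hypothesis on [f] by [|l|] shows that
    [T] has Lipschitz constant [1 / 2]; the hypothesis on [w] says that [T] moves
    the centre [c] by at most [s / 2], so that [T] preserves the closed disk of
    radius [s]. *)
Lemma approx_linear_surjective (D : C -> Prop) (f : C -> C) (l c w : C) (s : R) :
  l <> RtoC 0 -> approx_linear_on D f l ->
  (forall z : C, Cmod (z - c)%C <= s -> D z) ->
  Cmod (w - f c)%C <= Cmod l / 2 * s ->
  exists z : C, Cmod (z - c)%C <= s /\ f z = w.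
Proof.
  intros Hl H HD Hw.
  assert (Hl' := proj1 (Cmod_gt_0 l) Hl).
  assert (Hs : 0 <= s).
  { apply Rmult_le_reg_l with (Cmod l / 2); [lra|].
    rewrite Rmult_0_r; eapply Rle_trans; [apply Cmod_ge_0|exact Hw]. }
  assert (Hc : D c).
  { apply HD.
    replace (c - c)%C with (RtoC 0) by ring.
    rewrite Cmod_0; exact Hs. }
  set (T := fun z : C => (z - (f z - w) / l)%C).
  assert (HT : forall z z', D z -> D z' ->
    Cmod (T z - T z')%C <= 1 / 2 * Cmod (z - z')%C).
  { intros z z' Hz Hz'.
    replace (T z - T z')%C with (- (f z - f z' - l * (z - z')) / l)%C
      by (unfold T; field; exact Hl).
    rewrite Cmod_div, Cmod_opp by exact Hl.
    apply Rle_div_l; [exact Hl'|].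
    assert (H1 := H z z' Hz Hz'); lra. }
  assert (HTc : Cmod (T c - c)%C <= s / 2).
  { replace (T c - c)%C with ((w - f c) / l)%C by (unfold T; field; exact Hl).
    rewrite Cmod_div by exact Hl.
    apply Rle_div_l; [exact Hl'|]; lra. }
  destruct (contraction_fixed_point T c s (1 / 2)) as (z & Hz & Hfix);
    [exact Hs|lra| |intros; apply HT; auto|].
  - intros z Hz.
    assert (H1 := Cmod_minus_triangle (T z) (T c) c).
    assert (H2 := HT z c (HD z Hz) Hc).
    lra.
  - exists z; split; [exact Hz|].
    replace (f z) with (w + (z - T z) * l)%C by (unfold T; field; exact Hl).
    rewrite Hfix; ring.
Qed.

Lemma disk_subdisk (c : C) (r : R) (z : C) : disk c r z ->
  exists s : R, 0 < s /\ forall w : C, Cmod (w - z)%C <= s -> disk c r w.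
Proof.
  unfold disk; intros Hz.
  exists ((r - Cmod (z - c)%C) / 2); split; [lra|].
  intros w Hw.
  assert (H := Cmod_minus_triangle w z c); lra.
Qed.

Lemma approx_linear_open_image (c : C) (r : R) (f : C -> C) (l : C) :
  l <> RtoC 0 -> approx_linear_on (disk c r) f l ->
  @open C_UniformSpace (image f (disk c r)).
Proof.
  intros Hl H w0 (z & Hz & E); subst w0.
  destruct (disk_subdisk c r z Hz) as (s & Hs & Hsub).
  assert (Hl' := proj1 (Cmod_gt_0 l) Hl).
  apply locally_disk.
  exists (Cmod l / 2 * s); split; [apply Rmult_lt_0_compat; lra|].
  intros w Hw.
  destruct (approx_linear_surjective (disk c r) f l z w s Hl H Hsub) as (z' & Hz' & E).
  { apply Rlt_le; exact Hw. }
  exists z'; auto.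
Qed.

(** If the derivative were zero, [f] would contract small distances to [z] by a
    factor [|l| / 4], against the lower bound [|l| / 2] of
    [approx_linear_expanding].  The test point [z'] lies to the right of [z],
    close enough for both estimates. *)
Lemma approx_linear_derivative_neq_0 (c : C) (r : R) (f : C -> C) (l z m : C) :
  l <> RtoC 0 -> approx_linear_on (disk c r) f l -> disk c r z ->
  strict_derivative f z m -> m <> RtoC 0.
Proof.
  intros Hl H Hz Hm E; subst m.
  assert (Hl' := proj1 (Cmod_gt_0 l) Hl).
  destruct (Hm (Cmod l / 4) ltac:(lra)) as (d & Hd & Hbound).
  destruct (disk_subdisk c r z Hz) as (s & Hs & Hsub).
  set (t := Rmin s (d / 2)).
  assert (Ht : 0 < t) by (apply Rmin_pos; lra).
  assert (Ht1 : t <= s) by apply Rmin_l.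
  assert (Ht2 : t <= d / 2) by apply Rmin_r.
  set (z' := (z + t)%C).
  assert (Hz' : Cmod (z' - z)%C = t).
  { unfold z'; replace (z + t - z)%C with (RtoC t) by ring.
    rewrite Cmod_R; apply Rabs_pos_eq; lra. }
  assert (H1 := approx_linear_expanding _ f l H z' z (Hsub z' ltac:(lra)) Hz).
  assert (H2 := Hbound z' z ltac:(unfold disk; lra) (disk_center z d Hd)).
  replace (f z' - f z - 0 * (z' - z))%C with (f z' - f z)%C in H2 by ring.
  rewrite Hz' in H1, H2.
  assert (0 < Cmod l * t) by (apply Rmult_lt_0_compat; assumption).
  lra.
Qed.

(** * The inverse map *)

Lemma inverse_lipschitz (D : C -> Prop) (f g : C -> C) (l : C) :
  l <> RtoC 0 -> approx_linear_on D f l -> inverse_on D (image f D) f g ->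
  forall w w' : C, image f D w -> image f D w' ->
    Cmod (g w - g w')%C <= 2 / Cmod l * Cmod (w - w')%C.
Proof.
  intros Hl H [_ Hg] w w' Hw Hw'.
  apply Cmod_gt_0 in Hl.
  destruct (Hg w Hw) as [Hd E].
  destruct (Hg w' Hw') as [Hd' E'].
  assert (H1 := approx_linear_expanding D f l H (g w) (g w') Hd Hd').
  rewrite E, E' in H1.
  apply Rmult_le_reg_l with (Cmod l / 2); [lra|].
  eapply Rle_trans; [exact H1|].
  apply Req_le; field; lra.
Qed.

Lemma lipschitz_continuous_on (V : C -> Prop) (g : C -> C) (L : R) :
  0 < L ->
  (forall w w' : C, V w -> V w' -> Cmod (g w - g w')%C <= L * Cmod (w - w')%C) ->
  @continuous_on C_UniformSpace C_UniformSpace V g.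
Proof.
  intros HL Hlip w Hw P HP.
  apply locally_disk in HP.
  destruct HP as (r & Hr & HP).
  apply locally_disk.
  exists (r / L); split; [apply Rdiv_lt_0_compat; assumption|].
  intros w' Hd Hw'.
  apply HP.
  unfold disk in *.
  eapply Rle_lt_trans; [apply Hlip; assumption|].
  rewrite Rmult_comm; apply Rlt_div_r; assumption.
Qed.

(** With [u = g w], the error [g w - g (f z) - (w - f z) / m] is
    [- (f u - f z - m (u - z)) / m].  Strict differentiability makes it small
    with respect to [u - z], and [|u - z| <= L |w - f z|] because [g] is
    Lipschitz; the tolerance [eps |m| / L] compensates the factors [L] and
    [1 / |m|]. *)
Lemma inverse_is_derive (D : C -> Prop) (f g : C -> C) (l z m : C) :
  l <> RtoC 0 -> approx_linear_on D f l -> D z ->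
  @open C_UniformSpace (image f D) -> inverse_on D (image f D) f g ->
  strict_derivative f z m -> m <> RtoC 0 ->
  @is_derive C_AbsRing C_NormedModule g (f z) (/ m)%C.
Proof.
  intros Hl H Hz Hopen Hg Hm Hm0.
  assert (Hl' := proj1 (Cmod_gt_0 l) Hl).
  assert (Hm' := proj1 (Cmod_gt_0 m) Hm0).
  assert (Hlip := inverse_lipschitz D f g l Hl H Hg).
  destruct (proj1 Hg z Hz) as [Hfz Egz].
  set (L := 2 / Cmod l) in *.
  assert (HL : 0 < L) by (apply Rdiv_lt_0_compat; lra).
  apply is_derive_of_Cmod; intros eps Heps.
  destruct (Hm (eps * Cmod m / L)) as (d & Hd & Hbound).
  { apply Rdiv_lt_0_compat; [apply Rmult_lt_0_compat|]; assumption. }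
  destruct (proj1 (locally_disk _ _) (Hopen _ Hfz)) as (r & Hr & HV).
  exists (Rmin r (d / L)); split.
  { apply Rmin_pos; [exact Hr|apply Rdiv_lt_0_compat; assumption]. }
  intros w Hw.
  assert (Hwr : disk (f z) r w).
  { eapply Rlt_le_trans; [exact Hw|apply Rmin_l]. }
  assert (Hwd : Cmod (w - f z)%C < d / L).
  { eapply Rlt_le_trans; [exact Hw|apply Rmin_r]. }
  assert (HVw := HV w Hwr).
  destruct (proj2 Hg w HVw) as [_ Efgw].
  assert (Hgw := Hlip w (f z) HVw Hfz).
  rewrite Egz in Hgw |- *.
  assert (Hgd : disk z d (g w)).
  { eapply Rle_lt_trans; [exact Hgw|].
    rewrite Rmult_comm; apply Rlt_div_r; assumption. }
  assert (Hb := Hbound (g w) z Hgd (disk_center z d Hd)).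
  rewrite Efgw in Hb.
  replace (g w - z - / m * (w - f z))%C
    with (- (w - f z - m * (g w - z)) / m)%C by (field; exact Hm0).
  rewrite Cmod_div, Cmod_opp by exact Hm0.
  apply Rle_div_l; [exact Hm'|].
  eapply Rle_trans; [exact Hb|].
  apply Rle_trans with (eps * Cmod m / L * (L * Cmod (w - f z)%C)).
  - apply Rmult_le_compat_l; [|exact Hgw].
    apply Rlt_le, Rdiv_lt_0_compat; [apply Rmult_lt_0_compat|]; assumption.
  - apply Req_le; field; lra.
Qed.

Lemma injective_inverse_exists (D : C -> Prop) (f : C -> C) :
  injective_on D f -> exists g : C -> C, inverse_on D (image f D) f g.
Proof.
  intros Hinj.
  exists (fun w => epsilon (inhabits (RtoC 0)) (fun z => D z /\ f z = w)).
  assert (Hspec : forall w, image f D w ->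
    let z := epsilon (inhabits (RtoC 0)) (fun z => D z /\ f z = w) in
    D z /\ f z = w).
  { intros w Hw; apply epsilon_spec; exact Hw. }
  split; [|exact Hspec].
  intros z Hz.
  assert (HV : image f D (f z)) by (exists z; auto).
  split; [exact HV|].
  destruct (Hspec (f z) HV) as [HD E].
  apply Hinj; assumption.
Qed.

Lemma analytic_strict_derivative (Omega : C -> Prop) (f : C -> C) (c : C) :
  analytic_on Omega f -> Omega c -> exists l : C, strict_derivative f c l.
Proof.
  intros hf Hc.
  destruct (hf c Hc) as (rho & Hrho & _ & a & Ha).
  exists (a 1%nat).
  apply (pseries_strict_derivative f c rho a Hrho Ha).
Qed.

(** * The inverse function theorem for analytic functions *)

Theorem theorem8p1 (Omega : C -> Prop) (f : C -> C) (z0 : C)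
    (hOmega : open Omega) (hf : analytic_on Omega f)
    (hz0 : Omega z0) (hf' : C_derive f z0 <> RtoC 0) :
  exists r : R, (0 < r)%R /\
    let D := disk z0 r in
    let V := image f D in
    ((forall z : C, D z -> Omega z) /\ injective_on D f) /\
    (open V /\ V (f z0)) /\
    exists g : C -> C,
      (inverse_on D V f g /\ continuous_on V g) /\
      complex_differentiable_on V g.
Proof.
  destruct (analytic_strict_derivative Omega f z0 hf hz0) as [l Hl].
  rewrite (is_C_derive_unique f z0 l (strict_derivative_is_derive f z0 l Hl)) in hf'.
  assert (Hl' := proj1 (Cmod_gt_0 l) hf').
  destruct (Hl (Cmod l / 2) ltac:(lra)) as (d & Hd & Hbound).
  destruct (proj1 (locally_disk z0 Omega) (hOmega z0 hz0)) as (s & Hs & Hsub).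
  exists (Rmin d s); split; [apply Rmin_pos; assumption|].
  intros D V.
  assert (HD : forall z, D z -> disk z0 d z /\ Omega z).
  { intros z Hz; split.
    - eapply Rlt_le_trans; [exact Hz|apply Rmin_l].
    - apply Hsub; eapply Rlt_le_trans; [exact Hz|apply Rmin_r]. }
  assert (Happ : approx_linear_on D f l).
  { intros z w Hz Hw; apply Hbound; apply HD; assumption. }
  assert (Hinj := approx_linear_injective D f l hf' Happ).
  assert (Hopen := approx_linear_open_image z0 (Rmin d s) f l hf' Happ).
  destruct (injective_inverse_exists D f Hinj) as [g Hg].
  split; [split; [intros z Hz; apply HD, Hz|exact Hinj]|].
  split.
  { split; [exact Hopen|].
    exists z0; split; [apply disk_center, Rmin_pos; assumption|reflexivity]. }
  exists g; split; [split; [exact Hg|]|].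
  - apply (lipschitz_continuous_on V g (2 / Cmod l)).
    + apply Rdiv_lt_0_compat; lra.
    + exact (inverse_lipschitz D f g l hf' Happ Hg).
  - intros w (z & Hz & E); subst w.
    destruct (analytic_strict_derivative Omega f z hf (proj2 (HD z Hz))) as [m Hm].
    exists (/ m)%C.
    apply (inverse_is_derive D f g l z m); try assumption.
    apply (approx_linear_derivative_neq_0 z0 (Rmin d s) f l z m hf' Happ Hz Hm).
Qed.
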